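(* Let $\mathbb{F}=\mathbb{C}$, let $N\ge2$, $M\ge2$ and $Q$ be integers with $1\le Q\le M-1$, write $\mathcal{M}=\{1,\dots,M\}$, let $0<\epsilon<1$, and let $\mathbf{H}_1,\dots,\mathbf{H}_M$ be $N\times N$ complex Hermitian positive semidefinite matrices. Let $v^{\min}_{\rm QP}$ be the optimal value of (P1): minimize $\|\mathbf{w}\|^2$ over $\mathbf{w}\in\mathbb{C}^N$, $\boldsymbol\beta\in\{0,1\}^M$ subject to $\mathbf{w}^H\mathbf{H}_i\mathbf{w}\ge\beta_i+(1-\beta_i)\epsilon$ ($i\in\mathcal{M}$) and $\sum_i\beta_i=Q$; and let $v^{\min}_{\rm SDP2}$ be the optimal value of (SDP2): minimize $\mathrm{Tr}[\mathbf{X}]$ over Hermitian $N\times N$ matrices $\mathbf{X}\succeq0$ and $\boldsymbol\beta\in\mathbb{R}^M$ subject to $\mathrm{Tr}[\mathbf{H}_i\mathbf{X}]\ge\beta_i+(1-\beta_i)\epsilon$ ($i\in\mathcal{M}$), $\sum_i\beta_i=Q$, $0\le\beta_i\le1$. Then $v^{\min}_{\rm QP}\le\bar\mu_{\mathbb{C}}\,v^{\min}_{\rm SDP2}$ with $$\bar\mu_{\mathbb{C}}=\max\left\{8\Big[M-Q+\frac{1}{c(\epsilon)}Q\Big],\ \frac{24(\sqrt{M}-1)^2}{c(\epsilon)}\right\},$$ where $c(\epsilon)=\epsilon+\frac{1-\epsilon}{M-Q+1}$.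
   Context: ${}^H$ denotes conjugate transpose. *)

(* Defs.v *)
From HB Require Import structures.
From mathcomp Require Import all_boot all_order all_algebra.
From mathcomp Require Import all_classical all_reals ereal.
From mathcomp Require Import complex.
Set Implicit Arguments. Unset Strict Implicit. Unset Printing Implicit Defensive.
Import Order.TTheory GRing.Theory Num.Theory.
Local Open Scope ring_scope.
Local Open Scope complex_scope.
Local Open Scope classical_set_scope.

Definition ctr (R : rcfType) (m n : nat) (A : 'M[R[i]]_(m, n)) : 'M[R[i]]_(n, m) :=
  (map_mx (@conjc R) A)^T.

(* Hermitian positive semidefinite: A^H = A and x^H A x >= 0 (real, nonnegative)
   for all x (order of the complex numbers: 0 <= z iff z is real and Re z >= 0). *)
Definition hpsd (R : rcfType) (n : nat) (A : 'M[R[i]]_n) : Prop :=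
  ctr A = A /\ forall x : 'cV[R[i]]_n, 0 <= (ctr x *m A *m x) 0 0.

Definition sqnorm (R : rcfType) (n : nat) (w : 'cV[R[i]]_n) : R :=
  \sum_(j < n) (complex.Re (w j 0) ^+ 2 + complex.Im (w j 0) ^+ 2).

Definition P1_feasible (R : rcfType) (N M Q : nat) (eps : R)
  (H : 'I_M -> 'M[R[i]]_N) (w : 'cV[R[i]]_N) (beta : 'I_M -> bool) : Prop :=
  (forall i, (((beta i)%:R + (1 - (beta i)%:R) * eps)%:C : R[i])
               <= (ctr w *m H i *m w) 0 0)
  /\ (\sum_(i < M) (beta i : nat))%N = Q.

Definition SDP2_feasible (R : rcfType) (N M Q : nat) (eps : R)
  (H : 'I_M -> 'M[R[i]]_N) (X : 'M[R[i]]_N) (beta : 'I_M -> R) : Prop :=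
  hpsd X
  /\ (forall i, ((beta i + (1 - beta i) * eps)%:C : R[i]) <= \tr (H i *m X))
  /\ \sum_(i < M) beta i = Q%:R
  /\ (forall i, 0 <= beta i <= 1).

(* Optimal values (infima in the extended reals; +oo if infeasible). *)
Definition v_QP (R : realType) (N M Q : nat) (eps : R) (H : 'I_M -> 'M[R[i]]_N)
  : \bar R :=
  ereal_inf [set (sqnorm w)%:E | w in
     [set w : 'cV[R[i]]_N | exists beta, P1_feasible Q eps H w beta]].

Definition v_SDP2 (R : realType) (N M Q : nat) (eps : R) (H : 'I_M -> 'M[R[i]]_N)
  : \bar R :=
  ereal_inf [set (complex.Re (\tr X))%:E | X in
     [set X : 'M[R[i]]_N | exists beta, SDP2_feasible Q eps H X beta]].

Definition c_eps (R : realType) (M Q : nat) (eps : R) : R :=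
  eps + (1 - eps) / (M - Q + 1)%:R.

Definition mu_bar (R : realType) (M Q : nat) (eps : R) : R :=
  Num.max (8 * ((M - Q)%:R + Q%:R / c_eps M Q eps))
          (24 * (Num.sqrt M%:R - 1) ^+ 2 / c_eps M Q eps).

(* Main.v *)
Require Import Defs.
From HB Require Import structures.
From mathcomp Require Import all_boot all_order all_algebra.
From mathcomp Require Import all_classical all_reals ereal.
From mathcomp Require Import topology normedtype sequences derive.
From mathcomp Require Import exp.
From mathcomp Require Import complex spectral zify ring lra.
Set Implicit Arguments. Unset Strict Implicit. Unset Printing Implicit Defensive.
Import Order.TTheory GRing.Theory Num.Theory.
Import numFieldNormedType.Exports.
Local Open Scope ring_scope.
Local Open Scope complex_scope.

(** Write [H_i = G_i^H G_i] and [X = F F^H]; for weights [a_i > 0] one looks for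
    [w] with [w^H H_i w >= a_i Tr(H_i X)] and [|w|^2 <= 8 (sum_i a_i) Tr X].
    Replace each column [q] of [F] by [k^2] copies of [q / k] and add all copies
    with independent uniform phases in [{1, -1, i, -i}].  Averaging
    [exp (- b |z + phase * v|^2)] over one phase gives at most
    [exp (- b |v|^2) * exp (- (b - b^2 |v|^2) |z|^2)], a discrete substitute for
    Gaussian integration; iterating it, and letting [k] be large,
    [E exp (- s |h w|^2 / E |h w|^2) <= (4 / 3) / (1 + s)] for every row [h].
    By convexity of [exp] the same bound holds for
    [Y_i = w^H H_i w / Tr(H_i X)].  With [K = sum_i a_i] this yields
    [E (sum_i exp (- 2 K Y_i / a_i) + |w|^2 / (4 Tr X)) <= 2/3 + 1/4 < 1], and
    since [1 - exp (- x) <= x], some outcome [w] can be rescaled as wanted.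

    For the theorem, at least [Q] of the [beta_i] are [>= 1 / (M - Q + 1)]; on
    [Q] such indices [Tr(H_i X) >= c(eps)] and [a_i = 1 / c(eps)], elsewhere
    [a_i = 1].  This gives the first term of the maximum defining [mu_bar]. *)

(** * Exponential inequalities and the average over one phase *)

Lemma nonincreasing_is_derive (R : realType) (f f' : R -> R) :
  (forall y : R, is_derive y (1 : R) f (f' y)) -> (forall y, 0 < y -> f' y <= 0) ->
  forall x, 0 <= x -> f x <= f 0.
Proof.
move=> df f'0 x x0.
have derf (y : R) : derivable f y 1 by case: (df y) => + _; exact.
apply: (@ler0_derive1_nincry R f 0) => //.
- move=> y; rewrite in_itv/= andbT => y0.
  by rewrite derive1E (@derive_val _ _ _ _ _ _ _ (df y)) f'0.
- exact: derivable_within_continuous.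
Qed.

(** The derivative of [(1 - y) * expR (2 * y) - y] is nonpositive because
    [1 - 2 * y <= expR (- (2 * y))]. *)
Lemma onesubM_expR_le (R : realType) (x : R) : 0 <= x ->
  (1 - x) * expR (2 * x) <= 1 + x.
Proof.
move=> x0; rewrite -lerBlDr.
pose f (y : R) := (1 - y) * expR (2 * y) - y.
pose f' (y : R) := (1 - 2 * y) * expR (2 * y) - 1.
suff : f x <= f 0 by rewrite /f mulr0 expR0 !subr0 mulr1.
apply: (@nonincreasing_is_derive R f f') => // [y|y y0].
  by apply: is_derive_eq; rewrite /GRing.scale /f' /=; ring.
rewrite subr_le0 -ler_pdivlMr ?expR_gt0// div1r -expRN.
exact: expR_ge1Dx.
Qed.

(** This is [cosh p <= exp (p^2 / 2)]. The quotient of the two sides decreases for [p >= 0]: once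
    [expR (- y - y ^+ 2 / 2)] is factored out, the sign of its derivative is [onesubM_expR_le]. *)
Lemma expRDexpRN_le (R : realType) (p : R) :
  expR p + expR (- p) <= 2 * expR (p ^+ 2 / 2).
Proof.
wlog p0 : p / 0 <= p.
  move=> W; have [/W//|/ltW p0] := leP 0 p.
  by have := W (- p); rewrite oppr_ge0 => /(_ p0); rewrite opprK sqrrN addrC.
pose f (y : R) := expR (y - y ^+ 2 / 2) + expR (- y - y ^+ 2 / 2).
pose f' (y : R) :=
  (1 - y) * expR (y - y ^+ 2 / 2) - (1 + y) * expR (- y - y ^+ 2 / 2).
suff : f p <= f 0.
  rewrite /f expr0n/= mul0r oppr0 addr0 expR0 !expRB -mulrDl.
  by rewrite ler_pdivrMr ?expR_gt0.
apply: (@nonincreasing_is_derive R f f') => // [y|y y0].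
  by apply: is_derive_eq; rewrite /GRing.scale /f' /=; field.
rewrite subr_le0 (_ : y - y ^+ 2 / 2 = 2 * y + (- y - y ^+ 2 / 2)); last by ring.
by rewrite expRD mulrA ler_pM2r ?expR_gt0// onesubM_expR_le// ltW.
Qed.

Definition sqnormC (R : rcfType) (z : R[i]) : R :=
  complex.Re z ^+ 2 + complex.Im z ^+ 2.

Lemma sqnormC_ge0 (R : rcfType) (z : R[i]) : 0 <= sqnormC z.
Proof. by rewrite addr_ge0// sqr_ge0. Qed.

(* The four exponentials pair up as [cosh X + cosh Y], and
   [cosh X + cosh Y = 2 cosh ((X + Y) / 2) cosh ((X - Y) / 2)]. *)
Lemma phase_average_expR_le (R : realType) (b : R) (z v : R[i]) :
  expR (- (b * sqnormC (z + v))) + expR (- (b * sqnormC (z - v))) +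
  expR (- (b * sqnormC (z + 'i * v))) + expR (- (b * sqnormC (z - 'i * v)))
  <= 4 * (expR (- (b * sqnormC v)) *
          expR (- ((b - b ^+ 2 * sqnormC v) * sqnormC z))).
Proof.
case: z v => x y [c d]; rewrite /sqnormC /=.
rewrite !(mul0r, mul1r, add0r, sub0r, addr0).
(* [p] and [q] are the half sum and half difference of [X] and [Y], and [s] is the common exponent.
   Moreover [p^2 / 2 + q^2 / 2 = b^2 |z|^2 |v|^2], which is the correction in the damped
   exponent. *)
pose p := b * (x * c + y * d + (y * c - x * d)).
pose q := b * (x * c + y * d - (y * c - x * d)).
pose s := - (b * (x ^+ 2 + y ^+ 2 + c ^+ 2 + d ^+ 2)).
have eX e t : e = s + t -> expR e = expR s * expR t by move=> ->; exact: expRD.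
rewrite [X in X + _ + _ + _](eX _ (- p + - q)); last by rewrite /p /q /s; ring.
rewrite [X in _ + X + _ + _](eX _ (p + q)); last by rewrite /p /q /s; ring.
rewrite [X in _ + X + _](eX _ (- p + q)); last by rewrite /p /q /s; ring.
rewrite [X in _ + X <= _](eX _ (p + - q)); last by rewrite /p /q /s; ring.
rewrite -[X in 4 * X]expRD [X in 4 * X](eX _ (p ^+ 2 / 2 + q ^+ 2 / 2)); last by rewrite /p /q /s; field.
rewrite !expRD -!mulrDr mulrCA ler_pM2l ?expR_gt0//.
rewrite (_ : 4 * _ = 2 * expR (p ^+ 2 / 2) * (2 * expR (q ^+ 2 / 2))); last by ring.
apply: le_trans (ler_pM _ _ (expRDexpRN_le p) (expRDexpRN_le q)).
- by rewrite le_eqVlt; apply/orP; left; apply/eqP; ring.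
- by rewrite addr_ge0 ?expR_ge0.
- by rewrite addr_ge0 ?expR_ge0.
Qed.

(** * The recursion for iterated phase averages *)

Section damping.
Variable R : realType.

(* Averaging [exp (- b |z|^2)] over the phases of increments of squared moduli
   [vs] gives at most [exp (- gain b vs) * exp (- damped b vs * |z|^2)]. *)
Fixpoint damped (b : R) (vs : seq R) : R :=
  if vs is v :: vs' then damped b vs' - damped b vs' ^+ 2 * v else b.

Fixpoint gain (b : R) (vs : seq R) : R :=
  if vs is v :: vs' then gain b vs' + damped b vs' * v else 0.

(** [damped] is an Euler scheme for [B' = - B^2], whose solution is [b / (1 + b S)]; the second
    bound follows from [(1 - x) (1 + x) <= 1] with [x = be * v]. For the third,
    [exp (- x) (1 - x^2) <= 1 - x], and the losses [x^2 <= b^2 delta v] add up to at most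
    [b^2 delta S]. Together they bound [exp (- gain)] by nearly the Gaussian value
    [1 / (1 + b S)]. *)
Lemma damped_bounds (b delta : R) (vs : seq R) : 0 < b -> b * delta < 1 ->
  {in vs, forall v, 0 <= v <= delta} ->
  [/\ 0 < damped b vs <= b,
      damped b vs * (1 + b * \sum_(v <- vs) v) <= b &
      expR (- gain b vs) * (b * (1 - b ^+ 2 * delta * \sum_(v <- vs) v))
        <= damped b vs].
Proof.
move=> b0 bd1; elim: vs => [_|v vs IH vsd] /=.
  by rewrite big_nil !mulr0 addr0 subr0 oppr0 expR0 mul1r mulr1 b0 lexx.
have /andP[v0 vd] := vsd v (mem_head _ _).
have {IH} [|/andP[]] := IH; first by move=> u uvs; apply: vsd; rewrite inE uvs orbT.
have : 0 <= \sum_(u <- vs) u.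
  rewrite big_seq; apply: sumr_ge0 => u uvs.
  by have /andP[] : 0 <= u <= delta by apply: vsd; rewrite inE uvs orbT.
rewrite big_cons; move: (\sum_(u <- vs) u) (damped b vs) (gain b vs).
move=> S be g S0 be0 beb beS gbe.
have d0 : 0 <= delta by exact: le_trans vd.
have x0 : 0 <= be * v by rewrite mulr_ge0// ltW.
have x1 : be * v < 1.
  by apply: le_lt_trans bd1; rewrite ler_pM// ltW.
have y0 : 0 <= b ^+ 2 * delta * v.
  by rewrite !mulr_ge0 ?exprn_ge0 ?(ltW b0).
have y1 : b ^+ 2 * delta * v <= 1.
  rewrite (_ : _ * v = (b * delta) * (b * v)); last by ring.
  have bv : b * v <= b * delta by rewrite ler_pM2l.
  by rewrite mulr_ile1 ?mulr_ge0// ?(ltW b0)// ?(ltW bd1)//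
             (le_trans bv)// ltW.
have xy : (be * v) ^+ 2 <= b ^+ 2 * delta * v.
  rewrite exprMn -mulrA ler_pM ?sqr_ge0 ?ler_sqr ?nnegrE ?(ltW be0) ?(ltW b0)//.
  by rewrite expr2 ler_wpM2r.
split.
- apply/andP; split; nra.
- have : b * (1 - be * v) * (1 + be * v) <= b by nra.
  apply: le_trans.
  rewrite (_ : b * _ * _ = b * (1 - be * v) + (1 - be * v) * (b * (be * v))); last by ring.
  rewrite (_ : (be - _) * _ = be * (1 + b * S) * (1 - be * v)
      + (1 - be * v) * (b * (be * v))); last by ring.
  by rewrite lerD2r ler_wpM2r// subr_ge0 ltW.
- have ex : expR (- (be * v)) * (1 + be * v) <= 1.
    rewrite expRN mulrC ler_pdivrMr ?expR_gt0// mul1r; exact: expR_ge1Dx.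
  rewrite opprD expRD.
  set y := b ^+ 2 * delta * v in y0 y1 xy *.
  set t := b ^+ 2 * delta * S in gbe *.
  have t0 : 0 <= t by rewrite /t !mulr_ge0 ?exprn_ge0 ?(ltW b0).
  have -> : b ^+ 2 * delta * (v + S) = t + y by rewrite /t /y; ring.
  have e0 : 0 <= expR (- g) * b by rewrite mulr_ge0 ?expR_ge0 ?(ltW b0).
  have step : expR (- g) * b * (1 - (t + y)) <= be * (1 - (be * v) ^+ 2).
    apply: (@le_trans _ _ (expR (- g) * b * ((1 - t) * (1 - y)))).
      by rewrite ler_wpM2l//; nra.
    rewrite mulrA -[X in X * (1 - y)]mulrA.
    apply: (@le_trans _ _ (be * (1 - y))); first by rewrite ler_wpM2r// subr_ge0.
    by rewrite ler_pM2l// lerB.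
  rewrite (_ : _ * _ * _ = expR (- (be * v)) * (expR (- g) * b * (1 - (t + y))));
    last by ring.
  apply: (@le_trans _ _ (expR (- (be * v)) * (be * (1 - (be * v) ^+ 2)))).
    by rewrite ler_wpM2l ?expR_ge0.
  rewrite (_ : expR _ * _ = be * (1 - be * v) * (expR (- (be * v)) * (1 + be * v)));
    last by ring.
  rewrite (_ : be - _ = be * (1 - be * v) * 1); last by ring.
  by rewrite ler_wpM2l// mulr_ge0 ?(ltW be0)// subr_ge0 ltW.
Qed.

End damping.

(** * Derandomized choice of the phases *)

Lemma sqnorm_ge0 (R : rcfType) n (w : 'cV[R[i]]_n) : 0 <= sqnorm w.
Proof. by apply: sumr_ge0 => j _; exact: sqnormC_ge0. Qed.

Lemma sqnorm_phases (R : rcfType) n (w p : 'cV[R[i]]_n) :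
  sqnorm (w + p) + sqnorm (w - p) + sqnorm (w + 'i *: p) + sqnorm (w - 'i *: p)
  = 4 * (sqnorm w + sqnorm p).
Proof.
rewrite /sqnorm -!big_split/= mulr_sumr; apply: eq_bigr => j _; rewrite !mxE.
by case: (w j 0) (p j 0) => x y [c d] /=; ring.
Qed.

(** Method of conditional expectations: the right-hand side bounds the mean over the phases still to
    be chosen, and for each [p] one of the four phases does not increase it. *)
Lemma exists_phases (R : realType) (N : nat) (I : finType) (c b : I -> R)
    (h : I -> 'rV[R[i]]_N) (d : R) (ps : seq 'cV[R[i]]_N) (w0 : 'cV[R[i]]_N) :
  (forall k, 0 <= c k) -> 0 <= d ->
  let vs k := [seq sqnormC ((h k *m p) 0 0) | p <- ps] in
  exists w : 'cV[R[i]]_N,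
  \sum_k c k * expR (- (b k * sqnormC ((h k *m w) 0 0))) + d * sqnorm w <=
  \sum_k c k * (expR (- gain (b k) (vs k)) *
               expR (- (damped (b k) (vs k) * sqnormC ((h k *m w0) 0 0))))
  + d * (sqnorm w0 + \sum_(p <- ps) sqnorm p).
Proof.
move=> c0 d0.
pose V (qs : seq 'cV[R[i]]_N) k := [seq sqnormC ((h k *m q) 0 0) | q <- qs].
pose G (qs : seq 'cV[R[i]]_N) u := \sum_k c k * (expR (- gain (b k) (V qs k)) *
               expR (- (damped (b k) (V qs k) * sqnormC ((h k *m u) 0 0))))
  + d * (sqnorm u + \sum_(q <- qs) sqnorm q).
move=> vs; rewrite -/(G ps w0) {}/vs; elim: ps w0 => [|p ps IH] w0 /=.
  exists w0; rewrite /G big_nil addr0 lerD2r ler_sum// => k _ /=.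
  by rewrite oppr0 expR0 mul1r.
suff avg : G ps (w0 + p) + G ps (w0 - p) + G ps (w0 + 'i *: p) +
    G ps (w0 - 'i *: p) <= 4 * G (p :: ps) w0.
  have [u Gu] : exists u, G ps u <= G (p :: ps) w0.
    have [|h1] := leP (G ps (w0 + p)) (G (p :: ps) w0); first by exists (w0 + p).
    have [|h2] := leP (G ps (w0 - p)) (G (p :: ps) w0); first by exists (w0 - p).
    have [|h3] := leP (G ps (w0 + 'i *: p)) (G (p :: ps) w0).
      by exists (w0 + 'i *: p).
    exists (w0 - 'i *: p); lra.
  have [w hw] := IH u.
  exists w; exact: le_trans hw Gu.
pose A (u : 'cV[R[i]]_N) := \sum_k c k * (expR (- gain (b k) (V ps k)) *
  expR (- (damped (b k) (V ps k) * sqnormC ((h k *m u) 0 0)))).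
pose A' := \sum_k c k * (expR (- gain (b k) (V (p :: ps) k)) *
  expR (- (damped (b k) (V (p :: ps) k) * sqnormC ((h k *m w0) 0 0)))).
have avgA : A (w0 + p) + A (w0 - p) + A (w0 + 'i *: p) + A (w0 - 'i *: p)
    <= 4 * A'.
  rewrite /A /A' -!big_split mulr_sumr; apply: ler_sum => k _ /=.
  rewrite opprD expRD.
  have aux C e x1 x2 x3 x4 f g : 0 <= C -> 0 <= e -> x1 + x2 + x3 + x4 <= 4 * (f * g) ->
      C * (e * x1) + C * (e * x2) + C * (e * x3) + C * (e * x4)
      <= 4 * (C * (e * f * g)) :> R.
    move=> C0 e0 /(ler_wpM2l (mulr_ge0 C0 e0)); lra.
  apply: aux; rewrite ?expR_ge0//.
  have := phase_average_expR_le (damped (b k) (V ps k))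
            ((h k *m w0) 0 0) ((h k *m p) 0 0).
  by rewrite !mulmxDr !mulmxN -!scalemxAr !mxE.
have GE u : G ps u = A u + d * (sqnorm u + \sum_(q <- ps) sqnorm q) by [].
have GE' : G (p :: ps) w0 =
    A' + d * (sqnorm w0 + (sqnorm p + \sum_(q <- ps) sqnorm q)).
  by rewrite /G big_cons.
rewrite !GE GE'; move: (sqnorm_phases w0 p) => {GE GE' IH}.
move: (A (w0 + p)) (A (w0 - p)) (A (w0 + 'i *: p)) (A (w0 - 'i *: p)) A' avgA.
move=> a1 a2 a3 a4 a5 avgA.
move: (sqnorm (w0 + p)) (sqnorm (w0 - p)) (sqnorm (w0 + 'i *: p)) (sqnorm (w0 - 'i *: p)).
move: (sqnorm w0) (sqnorm p) (\sum_(q <- ps) sqnorm q) => s sp S s0 s1 s2 s3 ss.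
have -> : s3 = 4 * (s + sp) - (s0 + s1 + s2) by rewrite -ss; ring.
lra.
Qed.

(** * Squared moduli and norms *)

Lemma sqnormC_eq0 (R : rcfType) (z : R[i]) : (sqnormC z == 0) = (z == 0).
Proof.
case: z => x y; rewrite /sqnormC paddr_eq0 ?sqr_ge0//= !sqrf_eq0.
by rewrite eq_complex.
Qed.

Lemma sqnormC0 (R : rcfType) : sqnormC (0 : R[i]) = 0.
Proof. by apply/eqP; rewrite sqnormC_eq0. Qed.

Lemma sqnormCZ (R : rcfType) (r : R) (z : R[i]) :
  sqnormC (r%:C * z) = r ^+ 2 * sqnormC z.
Proof. by case: z => x y; rewrite /sqnormC /=; ring. Qed.

Lemma mulr_conjc (R : rcfType) (z : R[i]) : conjc z * z = (sqnormC z)%:C.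
Proof.
by case: z => x y; rewrite /sqnormC /=; apply/eqP; rewrite eq_complex /=;
  apply/andP; split; apply/eqP; ring.
Qed.

Lemma sqnorm0 (R : rcfType) n : sqnorm (0 : 'cV[R[i]]_n) = 0.
Proof. by apply: big1 => j _; rewrite mxE; exact: sqnormC0. Qed.

Lemma sqnormZ (R : rcfType) n (r : R) (w : 'cV[R[i]]_n) :
  sqnorm (r%:C *: w) = r ^+ 2 * sqnorm w.
Proof.
by rewrite /sqnorm mulr_sumr; apply: eq_bigr => j _; rewrite mxE; exact: sqnormCZ.
Qed.

(** The squared Frobenius norm; with Gram factors it expresses the traces of the relaxation. *)
Definition sqnormF (R : rcfType) m n (A : 'M[R[i]]_(m, n)) : R :=
  \sum_i \sum_j sqnormC (A i j).

Lemma sqnormF_ge0 (R : rcfType) m n (A : 'M[R[i]]_(m, n)) : 0 <= sqnormF A.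
Proof. by do 2!(apply: sumr_ge0 => ? _); exact: sqnormC_ge0. Qed.

Lemma sqnormF_eq0 (R : rcfType) m n (A : 'M[R[i]]_(m, n)) :
  sqnormF A = 0 -> A = 0.
Proof.
move=> A0; apply/matrixP => i j; rewrite mxE.
have sum_ge0 i' : 0 <= \sum_j sqnormC (A i' j).
  by apply: sumr_ge0 => ? _; exact: sqnormC_ge0.
have /psumr_eq0P/(_ j isT) : \sum_j sqnormC (A i j) = 0.
  by apply: (psumr_eq0P _ A0).
by move=> /(_ (fun _ _ => sqnormC_ge0 _))/eqP; rewrite sqnormC_eq0 => /eqP.
Qed.

Lemma sum_sqnorm_col (R : rcfType) m n (A : 'M[R[i]]_(m, n)) :
  \sum_j sqnorm (col j A) = sqnormF A.
Proof.
rewrite /sqnormF exchange_big; apply: eq_bigr => j _; apply: eq_bigr => i _.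
by rewrite mxE.
Qed.

(** * Jensen's inequality and subdivision of the columns *)

Lemma expR_jensen (R : realType) (I : finType) (c x : I -> R) :
  (forall j, 0 <= c j) -> \sum_j c j = 1 ->
  expR (- \sum_j c j * x j) <= \sum_j c j * expR (- x j).
Proof.
move=> c0 c1; set m := \sum_j c j * x j.
(* The middle term is the tangent line of [exp (- x)] at the mean [m]. *)
apply: (@le_trans _ _ (\sum_j c j * (expR (- m) * (1 + (m - x j))))).
  under eq_bigr do rewrite mulrCA.
  rewrite -mulr_sumr -[leLHS]mulr1 ler_wpM2l ?expR_ge0//.
  under eq_bigr do rewrite addrA mulrBr.
  by rewrite sumrB -mulr_suml c1 mul1r -/m addrK.
apply: ler_sum => j _; rewrite ler_wpM2l// [in leRHS](_ : - x j = - m + (m - x j)).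
  by rewrite expRD ler_wpM2l ?expR_ge0// expR_ge1Dx.
by ring.
Qed.

Section subdivision.
Variables (R : realType) (N : nat).
Implicit Types (q : 'cV[R[i]]_N) (qs : seq 'cV[R[i]]_N).

(** Sums of functions homogeneous of degree two are preserved for [k > 0], while each single
    increment shrinks by [k^2], which makes [delta] small in [damped_bounds]. *)
Definition subdivide (k : nat) qs : seq 'cV[R[i]]_N :=
  flatten [seq nseq (k ^ 2) ((k%:R^-1)%:C *: q) | q <- qs].

Lemma sum_subdivide (k : nat) qs (f : 'cV[R[i]]_N -> R) : (0 < k)%N ->
  (forall (r : R) q, f (r%:C *: q) = r ^+ 2 * f q) ->
  \sum_(p <- subdivide k qs) f p = \sum_(q <- qs) f q.
Proof.
move=> k0 fZ; rewrite big_flatten/= big_map; apply: eq_bigr => q _.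
rewrite big_nseq iter_addr addr0 fZ -mulrnAl exprVn -mulr_natr natrX.
by rewrite mulVf ?mul1r// expf_neq0// pnatr_eq0 -lt0n.
Qed.

Lemma gain_subdivide_le (h : 'rV[R[i]]_N) (k : nat) qs (s : R) :
  let u q := sqnormC ((h *m q) 0 0) in
  let V := \sum_(q <- qs) u q in
  0 < V -> 0 < s -> s < (k ^ 2)%:R -> 4 * s ^+ 2 <= (k ^ 2)%:R ->
  expR (- gain (s / V) [seq u p | p <- subdivide k qs]) <= 4 / 3 / (1 + s).
Proof.
move=> u V V0 s0 sk s2k.
have k20 : 0 < (k ^ 2)%:R :> R by exact: lt_trans sk.
have k0 : (0 < k)%N by move: k20; rewrite ltr0n expn_gt0 orbF.
have uZ (r : R) q : u (r%:C *: q) = r ^+ 2 * u q.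
  by rewrite /u -scalemxAr mxE sqnormCZ.
have sumV : \sum_(v <- [seq u p | p <- subdivide k qs]) v = V.
  by rewrite big_map sum_subdivide.
have [|||/andP[d0 _]] := @damped_bounds R (s / V) (V / (k ^ 2)%:R)
    [seq u p | p <- subdivide k qs].
- by rewrite divr_gt0.
- by rewrite mulrA divfK ?gt_eqF// ltr_pdivrMr// mul1r.
- move=> _ /mapP[p /flattenP[l /mapP[q qqs ->]]] /nseqP[-> _] ->.
  rewrite uZ mulr_ge0 ?sqnormC_ge0 ?sqr_ge0//= mulrC exprVn -natrX.
  rewrite ler_pM2r ?invr_gt0// /V (big_rem q)//= lerDl sumr_ge0// => ? _.
  exact: sqnormC_ge0.
rewrite sumV divfK ?gt_eqF//.
set g := expR _; set D := damped _ _ => Ds gD.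
have b0 : 0 < s / V by rewrite divr_gt0.
have g0 : 0 <= g by exact: expR_ge0.
rewrite ler_pdivlMr; last by lra.
(* With [delta = V / k^2] the relative loss is [s^2 / k^2 <= 1/4]; this is the origin of the factor
   [4 / 3]. *)
have : g * (s / V * (3 / 4)) <= D.
  apply: le_trans gD; rewrite ler_wpM2l// ler_wpM2l ?(ltW b0)//.
  rewrite (_ : _ * _ * V = s ^+ 2 / (k ^ 2)%:R); last first.
    by move: (_%:R) k20 => k2 k20; field; rewrite !gt_eqF.
  have : s ^+ 2 / (k ^ 2)%:R <= 1 / 4 by rewrite ler_pdivrMr//; lra.
  lra.
have s10 : 0 <= 1 + s by lra.
move=> /(ler_wpM2r s10) /le_trans/(_ Ds).
rewrite (_ : g * _ * _ = s / V * (g * (1 + s) * (3 / 4))); last by ring.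
by rewrite -[leRHS]mulr1 ler_pM2l// => ?; lra.
Qed.

End subdivision.

(** * Gram factorizations *)

Lemma ctrM (R : rcfType) m n p (A : 'M[R[i]]_(m, n)) (B : 'M[R[i]]_(n, p)) :
  ctr (A *m B) = ctr B *m ctr A.
Proof. by rewrite /ctr map_mxM trmx_mul. Qed.

Lemma ctrK (R : rcfType) m n (A : 'M[R[i]]_(m, n)) : ctr (ctr A) = A.
Proof. by apply/matrixP => i j; rewrite !mxE conjcK. Qed.

(** By the spectral theorem [A = P^H D P] with [P] unitary. Testing on the conjugated rows of [P]
    gives [D >= 0], so [G] can be the square root of [D] times [P]. *)
Lemma hpsd_gram (R : rcfType) n (A : 'M[R[i]]_n) : hpsd A ->
  exists G : 'M[R[i]]_n, A = ctr G *m G.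
Proof.
move=> [Aherm Apos].
have ctrE m p (B : 'M[R[i]]_(m, p)) : (map_mx Num.conj B^T) = ctr B.
  by rewrite /ctr map_trmx.
have /orthomx_spectralP : A \is normalmx by apply/normalmxP; rewrite ctrE Aherm.
have U := spectral_unitarymx A.
rewrite invmx_unitary// ctrE; move: (spectralmx A) (spectral_diag A) U => P d.
move=> /unitarymxP; rewrite ctrE => PP1 Ad.
have d_ge0 i : 0 <= d 0 i.
  have := Apos (ctr (row i P)); rewrite ctrK -row_mul.
  have -> : ctr (row i P) = col i (ctr P) by apply/colP => j; rewrite !mxE.
  have -> B C : (row i B *m col i C) 0 0 = (B *m C) i i :> R[i].
    by rewrite !mxE; apply: eq_bigr => j _; rewrite !mxE.
  by rewrite Ad !mulmxA PP1 mul1mx -mulmxA PP1 mulmx1 mxE eqxx mulr1n.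
exists (diag_mx (map_mx (@sqrtc R) d) *m P).
rewrite ctrM mulmxA -[_ *m _ *m diag_mx _]mulmxA {1}Ad; congr (_ *m _ *m _).
have -> : ctr (diag_mx (map_mx (@sqrtc R) d)) = diag_mx (map_mx (fun z => conjc (sqrtc z)) d).
  by rewrite /ctr map_diag_mx tr_diag_mx -map_mx_comp.
rewrite mulmx_diag; congr diag_mx; apply/rowP => i; rewrite !mxE.
rewrite (_ : conjc _ = sqrtc (d 0 i)) -?expr2 ?sqr_sqrtc//.
by have /ger0_Im := eq_ind_r is_true (d_ge0 i) (sqrtc_ge0 (d 0 i));
  case: (sqrtc _) => x y /= ->; rewrite oppr0.
Qed.

Lemma quad_gram (R : rcfType) m n (G : 'M[R[i]]_(m, n)) (w : 'cV[R[i]]_n) :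
  (ctr w *m (ctr G *m G) *m w) 0 0 = (sqnorm (G *m w))%:C.
Proof.
rewrite !mulmxA -ctrM -mulmxA; move: (G *m w) => u.
by rewrite mxE rmorph_sum; apply: eq_bigr => j _; rewrite !mxE mulr_conjc.
Qed.

Lemma mxtrace_gram (R : rcfType) m n (A : 'M[R[i]]_(m, n)) :
  \tr (A *m ctr A) = (sqnormF A)%:C.
Proof.
rewrite /mxtrace rmorph_sum; apply: eq_bigr => i _; rewrite mxE rmorph_sum.
by apply: eq_bigr => j _; rewrite !mxE mulrC mulr_conjc.
Qed.

(** * Rounding a Gram factor to a vector *)

Lemma exists_rounding (R : realType) (N m : nat) (I : finType) (i0 : I)
    (G : I -> 'M[R[i]]_N) (F : 'M[R[i]]_(N, m)) (a : I -> R) :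
  (forall i, 0 < a i) -> (forall i, 0 < sqnormF (G i *m F)) ->
  exists2 w : 'cV[R[i]]_N,
    sqnorm w <= 8 * (\sum_i a i) * sqnormF F &
    forall i, a i * sqnormF (G i *m F) <= sqnorm (G i *m w).
Proof.
move=> a0 V0; set K := \sum_i a i; set T := sqnormF F.
pose V i := sqnormF (G i *m F).
pose v (x : I * 'I_N) := \sum_j sqnormC ((G x.1 *m F) x.2 j).
have v0 x : 0 <= v x by apply: sumr_ge0 => ? _; exact: sqnormC_ge0.
have sumv i : \sum_j v (i, j) = V i by [].
have K0 : 0 < K.
  rewrite /K (bigD1 i0)//=; apply: ltr_wpDr => //.
  by apply: sumr_ge0 => ? _; exact: ltW.
have T0 : 0 < T.
  rewrite lt_neqAle sqnormF_ge0 andbT eq_sym; apply/eqP => /sqnormF_eq0 F0.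
  have := V0 i0; rewrite F0 mulmx0 /sqnormF big1 ?ltxx// => ? _.
  by rewrite big1// => ? _; rewrite mxE sqnormC0.
(* This choice gives [sum_i 1 / (1 + s i) <= sum_i a i / (2 K) = 1/2], hence [2/3] after the factor
   [4 / 3]. *)
pose s i := 2 * K / a i.
have s0 i : 0 < s i by rewrite /s divr_gt0// mulr_gt0.
have [k sk] : exists k : nat, forall i, s i < (k ^ 2)%:R /\ 4 * s i ^+ 2 <= (k ^ 2)%:R.
  pose S := \sum_i s i.
  have sS i : s i <= S.
    by rewrite /S (bigD1 i)//= lerDl sumr_ge0// => ? _; exact: ltW.
  have [k kS] : exists k : nat, 2 * S + 1 <= k%:R.
    exists (Num.trunc (2 * S + 1)).+1.
    have S0 : 0 <= 2 * S + 1.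
      by rewrite addr_ge0// mulr_ge0// sumr_ge0// => ? _; exact: ltW.
    by have /andP[_ /ltW] := truncn_itv S0.
  by exists k => i; rewrite natrX; have := sS i; have := s0 i; split; nra.
pose c (x : I * 'I_N) := v x / V x.1.
(* If [v x = 0], the division returns [0]; this is harmless because [c x = 0] too. *)
pose b (x : I * 'I_N) := s x.1 / v x.
pose h (x : I * 'I_N) := row x.2 (G x.1).
have hE x n (B : 'M[R[i]]_(N, n)) j : (h x *m B) 0 j = (G x.1 *m B) x.2 j.
  by rewrite /h -row_mul mxE.
have c0 x : 0 <= c x by rewrite divr_ge0// ltW//; exact: V0.
have sumc i : \sum_j c (i, j) = 1.
  by rewrite /c /= -mulr_suml sumv divff// gt_eqF//; exact: V0.
pose qs := [seq col j F | j <- enum 'I_m].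
have sumqs (f : 'cV[R[i]]_N -> R) : \sum_(q <- qs) f q = \sum_j f (col j F).
  by rewrite big_map big_enum.
have sumpair (f : I -> R) : \sum_x c x * f x.1 = \sum_i \sum_j c (i, j) * f i.
  by rewrite pair_bigA; apply: eq_bigr => -[].
have k0 : (0 < k)%N.
  have [+ _] := sk i0; case: (k) => //.
  by rewrite exp0n// => /(lt_trans (s0 i0)); rewrite ltxx.
have d0 : 0 <= (4 * T)^-1 by rewrite invr_ge0 mulr_ge0// ltW.
have [w] := exists_phases b h (subdivide k qs) 0 c0 d0.
rewrite sqnorm0 add0r sum_subdivide//; last by move=> r q; exact: sqnormZ.
rewrite sumqs sum_sqnorm_col -/T.
have -> : (4 * T)^-1 * T = 1 / 4 by field; rewrite gt_eqF.
set L := (X in X + _ <= _); set U := (X in _ <= X + _) => LU.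
have {}LU : L + (4 * T)^-1 * sqnorm w <= 11 / 12.
  suff : U <= 2 / 3 by lra.
  apply: (@le_trans _ _ (\sum_x c x * (4 / 3 / (1 + s x.1)))).
    apply: ler_sum => x _.
    rewrite mulmx0 mxE sqnormC0 mulr0 oppr0 expR0 mulr1.
    have [vx0|vx0] := eqVneq (v x) 0; first by rewrite /c vx0 !mul0r.
    have vE : v x = \sum_(q <- qs) sqnormC ((h x *m q) 0 0).
      by rewrite sumqs; apply: eq_bigr => j _; rewrite -hE colE mulmxA -colE [in RHS]mxE.
    have [sk1 sk2] := sk x.1.
    rewrite ler_wpM2l// /b vE gain_subdivide_le//.
    by rewrite -vE lt_neqAle eq_sym vx0 v0.
  rewrite (sumpair (fun i => 4 / 3 / (1 + s i))); under eq_bigr do rewrite -mulr_suml sumc mul1r.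
  apply: (@le_trans _ _ (\sum_i 4 / 3 * (a i / (2 * K)))).
    apply: ler_sum => i _; rewrite ler_pM2l; last by lra.
    rewrite -[leRHS]invf_div lef_pV2 ?posrE ?s0//; last by rewrite addr_gt0.
    by rewrite lerDr.
  rewrite -mulr_sumr -mulr_suml -/K.
  by rewrite (_ : 4 / 3 * _ = 2 / 3)//; field; rewrite gt_eqF.
(* Jensen over the rows of [G i], with weights [c (i, j)] summing to 1, merges them into one
   exponential; the terms of the other indices are nonnegative. *)
have Li i : expR (- (s i * sqnorm (G i *m w) / V i)) <= L.
  apply: (@le_trans _ _
    (\sum_j c (i, j) * expR (- (b (i, j) * sqnormC ((h (i, j) *m w) 0 0))))).
    apply: le_trans (expR_jensen (fun j => b (i, j) * sqnormC ((h (i, j) *m w) 0 0))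
      (fun j => c0 (i, j)) (sumc i)).
    rewrite ler_expR lerN2 mulrAC /sqnorm mulr_sumr; apply: ler_sum => j _.
    rewrite hE -/(sqnormC ((G i *m w) j 0)) mulrA ler_wpM2r ?sqnormC_ge0//.
    rewrite /c /b /=; have [->|vij0] := eqVneq (v (i, j)) 0.
      by rewrite !mul0r divr_ge0 ?ltW//; exact: V0.
    rewrite (_ : _ / _ * _ = s i / V i)//.
    by field; rewrite vij0 gt_eqF//; exact: V0.
  rewrite /L.
  have -> : \sum_x c x * expR (- (b x * sqnormC ((h x *m w) 0 0))) =
      \sum_i \sum_j c (i, j) * expR (- (b (i, j) * sqnormC ((h (i, j) *m w) 0 0))).
    by rewrite pair_bigA; apply: eq_bigr => -[].
  rewrite [leRHS](bigD1 i)//= lerDl sumr_ge0// => i' _.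
  by apply: sumr_ge0 => j _; rewrite mulr_ge0 ?expR_ge0.
(* Since [L <= 11/12 - |w|^2 / (4 T)], the inequality [1 - exp (- x) <= x] gives [Y_i >= a_i mu] for
   every [i]. Dividing [w] by the root of [mu] normalizes this, and [8 K T mu = T / 3 + |w|^2]
   controls the length. *)
pose mu := (1 / 12 + (4 * T)^-1 * sqnorm w) / (2 * K).
have dw0 : 0 <= (4 * T)^-1 * sqnorm w by rewrite mulr_ge0// sqnorm_ge0.
have mu0 : 0 < mu by rewrite divr_gt0 ?mulr_gt0//; lra.
exists ((Num.sqrt mu)^-1%:C *: w).
  rewrite sqnormZ exprVn sqr_sqrtr ?(ltW mu0)// mulrC ler_pdivrMr//.
  rewrite /mu (_ : _ * (_ / _) = T / 3 * 1 + sqnorm w); last first.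
    by field; rewrite !gt_eqF.
  lra.
move=> i; rewrite -scalemxAr sqnormZ exprVn sqr_sqrtr ?(ltW mu0)//.
rewrite [leRHS]mulrC ler_pdivlMr// -/(V i).
have Vi0 : 0 < V i by exact: V0.
have := expR_ge1Dx (- (s i * sqnorm (G i *m w) / V i)).
rewrite (_ : s i * _ / _ = 2 * K * (sqnorm (G i *m w) / (a i * V i))); last first.
  by rewrite /s; field; rewrite !gt_eqF.
move: (Li i).
rewrite (_ : s i * _ / _ = 2 * K * (sqnorm (G i *m w) / (a i * V i))); last first.
  by rewrite /s; field; rewrite !gt_eqF.
move=> Li1 Li2.
have : 2 * K * mu <= 2 * K * (sqnorm (G i *m w) / (a i * V i)).
  rewrite /mu [X in X <= _]mulrC divfK; first by lra.
  by rewrite gt_eqF// mulr_gt0.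
by rewrite ler_pM2l ?mulr_gt0// ler_pdivlMr ?mulr_gt0// mulrC.
Qed.

(** * Selecting the indices that satisfy the stronger constraint *)

Lemma card_notin (M : nat) (A : {set 'I_M}) :
  #|(fun i => i \notin A)| = (M - #|A|)%N.
Proof.
have := cardC (mem A); rewrite card_ord.
have -> : #|[predC mem A]| = #|(fun i => i \notin A)| by apply: eq_card.
by move=> cardE; rewrite -[X in (X - _)%N]cardE addKn.
Qed.

Lemma exists_large_weights (R : realFieldType) (M Q : nat) (beta : 'I_M -> R) :
  (1 <= Q)%N -> (Q <= M)%N -> \sum_i beta i = Q%:R -> (forall i, beta i <= 1) ->
  exists2 A : {set 'I_M}, #|A| = Q &
    forall i, i \in A -> ((M - Q + 1)%:R)^-1 <= beta i.
Proof.
move=> Q1 QM sumQ beta1; set r := _^-1.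
pose B := [set i | r <= beta i].
have r0 : 0 < r by rewrite invr_gt0 ltr0n addn1.
have r1 : r <= 1 by rewrite invf_le1 ?ltr0n ?addn1// ler1n.
suff QB : (Q <= #|B|)%N.
  exists [set i in take Q (enum B)].
    rewrite cardsE (card_uniqP _) ?take_uniq ?enum_uniq// size_take -cardE.
    by case: ltngtP QB.
  by move=> i; rewrite inE => /mem_take; rewrite mem_enum inE.
rewrite leqNgt; apply/negP => BQ.
have BM : (#|B| < M)%N by exact: leq_trans QM.
have [j jB] : exists j, j \notin B.
  apply/existsP; rewrite -negb_forall; apply/negP => /forallP allB.
  suff : (M <= #|B|)%N by rewrite leqNgt BM.
  by rewrite -[M in leqLHS]card_ord subset_leq_card//; apply/fintype.subsetP => i _.
(* Weights in [B] are at most 1 and the others are below [r]; the index [j] outside [B] makes the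
   inequality strict. *)
have : Q%:R < #|B|%:R + (M - #|B|)%:R * r.
  rewrite -sumQ (bigID (mem B))/= ler_ltD//.
    rewrite -sum1_card natr_sum; exact: ler_sum.
  have -> : (M - #|B|)%:R * r = \sum_(i | i \notin B) r.
    by rewrite sumr_const card_notin mulr_natl.
  rewrite (bigD1 j)//= [ltRHS](bigD1 j)//= ltr_leD//.
    by move: jB; rewrite inE -ltNge.
  by apply: ler_sum => i /andP[]; rewrite inE -ltNge => /ltW.
have rn : (M - Q + 1)%:R * r = 1 by rewrite mulfV// pnatr_eq0 addn1.
(* As [(M - Q + 1) r = 1] and [r <= 1], the part outside [B] contributes at most
   [(Q - #|B| - 1) + 1], so the total would be below [Q]. *)
have -> : (M - #|B| = (Q - #|B|.+1) + (M - Q + 1))%N by lia.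
have -> : Q%:R = #|B|%:R + (Q - #|B|.+1)%:R + 1 :> R.
  by rewrite -natrD natr1; congr (_%:R); lia.
rewrite natrD mulrDl rn.
have := ler_wpM2l (ler0n R (Q - #|B|.+1)) r1.
lra.
Qed.

(** * From the relaxation to (P1), and the optimal values *)

Lemma exists_P1_point (R : realType) (N M Q : nat) (eps : R)
    (H : 'I_M -> 'M[R[i]]_N) (X : 'M[R[i]]_N) (beta : 'I_M -> R) :
  (1 <= Q)%N -> (Q <= M)%N -> 0 < eps < 1 -> (forall i, hpsd (H i)) ->
  SDP2_feasible Q eps H X beta ->
  exists2 w, exists beta', P1_feasible Q eps H w beta' &
    sqnorm w <= 8 * ((M - Q)%:R + Q%:R / c_eps M Q eps) * complex.Re (\tr X).
Proof.
move=> Q1 QM /andP[e0 e1] Hpsd [Xpsd [HX [sumQ beta01]]].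
have beta1 i : beta i <= 1 by have /andP[] := beta01 i.
have [A cardA Abeta] := exists_large_weights Q1 QM sumQ beta1.
have M0 : (0 < M)%N by exact: leq_trans QM.
have /choice[G HG] : forall i, exists Gi : 'M[R[i]]_N, H i = ctr Gi *m Gi.
  by move=> i; exact: hpsd_gram.
have [F0 XF0] := hpsd_gram Xpsd.
pose F := ctr F0; have XF : X = F *m ctr F by rewrite /F ctrK.
have trHX i : \tr (H i *m X) = (sqnormF (G i *m F))%:C.
  by rewrite HG XF -mxtrace_gram ctrM -!mulmxA mxtrace_mulC !mulmxA.
have Vge i : beta i + (1 - beta i) * eps <= sqnormF (G i *m F).
  by have := HX i; rewrite trHX lecR.
have Veps i : eps <= sqnormF (G i *m F).
  by apply: le_trans (Vge i); have /andP[] := beta01 i; nra.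
set c := c_eps M Q eps.
have c0 : 0 < c.
  by rewrite /c /c_eps addr_gt0// divr_gt0 ?subr_gt0// ltr0n addn1.
(* [c] is the value of [beta + (1 - beta) * eps] at [beta = 1 / (M - Q + 1)], and this expression
   increases with [beta] since [eps < 1]. *)
have VA i : i \in A -> c <= sqnormF (G i *m F).
  move=> /Abeta; set r := _^-1 => ri; apply: le_trans (Vge i).
  by rewrite /c /c_eps -/r; nra.
pose a i := if i \in A then c^-1 else 1.
have a0 i : 0 < a i by rewrite /a; case: ifP; rewrite ?invr_gt0.
have V0 i : 0 < sqnormF (G i *m F) by exact: lt_le_trans (Veps i).
have [w w_le wH] := exists_rounding (Ordinal M0) a0 V0.
have suma : \sum_i a i = (M - Q)%:R + Q%:R / c.
  rewrite (bigID (mem A))/= addrC; congr (_ + _).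
    under eq_bigr do rewrite /a ifN//.
    by rewrite sumr_const card_notin cardA.
  under eq_bigr => i iA do rewrite /a iA.
  by rewrite sumr_const cardA mulr_natl.
exists w; last by rewrite XF mxtrace_gram /= -suma.
exists (fun i => i \in A); split=> [i|]; last first.
  by rewrite -cardA -sum1_card [RHS]big_mkcond; apply: eq_bigr => i _; case: ifP.
rewrite HG quad_gram lecR; apply: le_trans (wH i); rewrite /a.
case: ifPn => iA /=.
  by rewrite subrr mul0r addr0 ler_pdivlMl// mulr1 VA.
by rewrite subr0 add0r !mul1r.
Qed.

Local Open Scope ereal_scope.

Theorem theorem2p6 (R : realType) (N M Q : nat) (eps : R)
  (H : 'I_M -> 'M[R[i]]_N) :
  (2 <= N)%N -> (2 <= M)%N -> (1 <= Q)%N -> (Q <= M - 1)%N ->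
  (0 < eps)%R -> (eps < 1)%R ->
  (forall i, hpsd (H i)) ->
  v_QP Q eps H <= (mu_bar M Q eps)%:E * v_SDP2 Q eps H.
Proof.
move=> _ M2 Q1 QM e0 e1 Hpsd.
have {}QM : (Q <= M)%N by rewrite (leq_trans QM)// leq_subr.
set K := (8 * ((M - Q)%:R + Q%:R / c_eps M Q eps))%R.
have c0 : (0 < c_eps M Q eps)%R.
  by rewrite /c_eps addr_gt0// divr_gt0 ?subr_gt0// ltr0n addn1.
have K0 : (0 < K)%R.
  by rewrite mulr_gt0// ltr_wpDl// divr_gt0// ltr0n.
have Kmu : (K <= mu_bar M Q eps)%R by rewrite /mu_bar le_max lexx.
have mu0 : (0 < mu_bar M Q eps)%R by exact: lt_le_trans Kmu.
(* Dividing by the positive factor leaves a lower bound to check at each feasible [X]; an infeasible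
   relaxation, with value [+oo], is covered too. *)
rewrite muleC -lee_pdivrMr//; apply/ereal_infP => _ [X [beta feas] <-].
rewrite lee_pdivrMr// -EFinM.
have [|w [beta' feas'] wK] := exists_P1_point Q1 QM _ Hpsd feas.
  by rewrite e0 e1.
apply: (@le_trans _ _ (sqnorm w)%:E).
  by apply: ereal_inf_lbound; exists w => //; exists beta'.
rewrite lee_fin mulrC (le_trans wK)// ler_wpM2r//.
(* Replacing [K] by [mu_bar] requires a nonnegative trace. *)
have /hpsd_gram[F ->] := feas.1.
by rewrite mxtrace_mulC mxtrace_gram /= sqnormF_ge0.
Qed.
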